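(* Let $\mathbb{K}$ be either $\mathbb{Z}$ or $\mathbb{R}$. Let $\mathcal{A}=(\mathrm{Ob}(\mathcal{A}),d_{\mathcal{A}})$ be a $\overline{\mathbb{K}}$-category and let $\mathbf{D}=(\mathrm{Ind}(\mathbf{D}),\mathbf{D}_0)$ be a $\overline{\mathbb{K}}$-extended L-convex set. Then: (i) $\mathcal{A}\cong [\![\,[\mathcal{A},\overline{\mathbb{K}}],\overline{\mathbb{K}}\,]\!]$ as $\overline{\mathbb{K}}$-categories; (ii) $\mathbf{D}\cong [\,[\![\mathbf{D},\overline{\mathbb{K}}]\!],\overline{\mathbb{K}}\,]$ as $\overline{\mathbb{K}}$-extended L-convex sets.
   Context: **Extended arithmetic.** $\mathbb{K}$ denotes either $\mathbb{Z}$ or $\mathbb{R}$. On $\mathbb{K}\cup\{-\infty,\infty\}$ use the usual total order, with $-\infty$ least and $\infty$ greatest; $\sup$ and $\inf$ are with respect to it, so $\sup\emptyset=-\infty$ and $\inf\emptyset=\infty$. Addition extends that of $\mathbb{K}$: $x+y=\infty$ if $x=\infty$ or $y=\infty$; otherwise $x+y=-\infty$ if $x=-\infty$ or $y=-\infty$. Subtraction extends that of $\mathbb{K}$: $y-x=-\infty$ if $x=\infty$ or $y=-\infty$; otherwise $y-x=\infty$ if $y=\infty$ or $x=-\infty$. (In particular $\infty-\infty=-\infty$ and $(-\infty)-(-\infty)=-\infty$.) **$\overline{\mathbb{K}}$-categories.** A $\overline{\mathbb{K}}$-category $\mathcal{A}$ is a pair $(\mathrm{Ob}(\mathcal{A}),d_{\mathcal{A}})$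 of a set and a map $d_{\mathcal{A}}:\mathrm{Ob}(\mathcal{A})\times\mathrm{Ob}(\mathcal{A})\to\mathbb{K}\cup\{-\infty,\infty\}$ with $d_{\mathcal{A}}(a,b)+d_{\mathcal{A}}(b,c)\ge d_{\mathcal{A}}(a,c)$ and $0\ge d_{\mathcal{A}}(a,a)$ for all $a,b,c$. A $\overline{\mathbb{K}}$-functor (nonexpansive map) $F:\mathcal{A}\to\mathcal{B}$ is a map $\mathrm{Ob}(F):\mathrm{Ob}(\mathcal{A})\to\mathrm{Ob}(\mathcal{B})$ with $d_{\mathcal{A}}(a,a')\ge d_{\mathcal{B}}(F(a),F(a'))$ for all $a,a'$. Write $\mathcal{A}\cong\mathcal{B}$ if there are $\overline{\mathbb{K}}$-functors $\mathcal{A}\to\mathcal{B}$ and $\mathcal{B}\to\mathcal{A}$ that are mutually inverse. $\overline{\mathbb{K}}$ itself is the $\overline{\mathbb{K}}$-category with set of objects $\mathbb{K}\cup\{-\infty,\infty\}$ and $d_{\overline{\mathbb{K}}}(x,y)=y-x$. **$\overline{\mathbb{K}}$-extended L-convex sets.** A $\overline{\mathbb{K}}$-extended L-convex set $\mathbf{D}$ is a pair $(\mathrm{Ind}(\mathbf{D}),\mathbf{D}_0)$ of a (possibly infinite) set $\mathrm{Ind}(\mathbf{D})$ and a subset $\mathbf{D}_0$ of the set $\overline{\mathbb{K}}^{\mathrm{Ind}(\mathbf{D})}$ of all maps $\mathrm{Ind}(\mathbf{D})\to\mathbb{K}\cup\{-\infty,\infty\}$ such that: (order completeness) for every subset $S\subseteq\mathbf{D}_0$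 (including $S=\emptyset$), the coordinate-wise $\inf$ and the coordinate-wise $\sup$ of $S$ belong to $\mathbf{D}_0$; (weight completeness) $p+\alpha\cdot\mathbf{1}\in\mathbf{D}_0$ for all $p\in\mathbf{D}_0$ and $\alpha\in\mathbb{K}\cup\{-\infty,\infty\}$, where $(p+\alpha\cdot\mathbf{1})(v)=p(v)+\alpha$. A homomorphism $\Phi:\mathbf{D}\to\mathbf{E}$ is a map $\mathrm{Ind}(\Phi):\mathrm{Ind}(\mathbf{E})\to\mathrm{Ind}(\mathbf{D})$ such that $\Phi_0(p):=p\circ\mathrm{Ind}(\Phi)\in\mathbf{E}_0$ for all $p\in\mathbf{D}_0$; two homomorphisms are equal iff their maps $\mathrm{Ind}$ are equal; identities and composites are those of the maps $\mathrm{Ind}$ (with direction reversed). Write $\mathbf{D}\cong\mathbf{E}$ if there are mutually inverse homomorphisms between them. $\overline{\mathbb{K}}$ itself is also regarded as the $\overline{\mathbb{K}}$-extended L-convex set $(\{\ast\},\mathbb{K}\cup\{-\infty,\infty\})$, identifying $\mathbb{K}\cup\{-\infty,\infty\}$ with $\overline{\mathbb{K}}^{\{\ast\}}$. **Constructions.** For a $\overline{\mathbb{K}}$-category $\mathcal{A}$, $[\mathcal{A},\overline{\mathbb{K}}]$ is the $\overline{\mathbb{K}}$-extended L-convex set $(\mathrm{Ob}(\mathcal{A}),[\mathcal{A},\overline{\mathbb{K}}]_0)$, where $[\mathcal{A},\overline{\mathbb{K}}]_0\subseteq\overline{\mathbb{K}}^{\mathrm{Ob}(\mathcal{A})}$ is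 the set of all $\overline{\mathbb{K}}$-functors $\mathcal{A}\to\overline{\mathbb{K}}$. For a $\overline{\mathbb{K}}$-extended L-convex set $\mathbf{D}$, $[\![\mathbf{D},\overline{\mathbb{K}}]\!]$ is the $\overline{\mathbb{K}}$-category whose set of objects $[\![\mathbf{D},\overline{\mathbb{K}}]\!]_0$ is the set of all homomorphisms $\mathbf{D}\to\overline{\mathbb{K}}$, with distance $d(\Phi,\Psi)=\sup_{p\in\mathbf{D}_0}\{\Psi_0(p)-\Phi_0(p)\}$. *)

(* Defs.v *)
From HB Require Import structures.
From mathcomp Require Import all_boot all_order all_algebra.
From mathcomp Require Import mathcomp_extra boolp classical_sets reals ereal.
Set Implicit Arguments.
Unset Strict Implicit.
Unset Printing Implicit Defensive.
Import Order.TTheory GRing.Theory Num.Theory DualAddTheory.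
Local Open Scope classical_set_scope.
Local Open Scope ring_scope.
Local Open Scope ereal_scope.

Variant ground := Integers | Reals of realType.

Definition ground_sort (K : ground) : realDomainType :=
  match K with
  | Integers => int
  | Reals R => R
  end.
Coercion ground_sort : ground >-> realDomainType.

(** In [K \cup {-oo, +oo}] the two additions of the library differ only on
    opposite infinities: [adde] (notation [+] in [%E]) gives [-oo] there and
    [dual_adde] (notation [+] in [%dE]) gives [+oo].  The addition used below
    is [dual_adde], and the subtraction is [y - x := adde y (oppe x)], so that
    [+oo - +oo = -oo - -oo = -oo]; that minus must not be read in [%dE], where
    it is built on [dual_adde]. *)

Section Suprema.
Variable K : ground.
Implicit Types S : set (\bar K).

(** The library's [ereal_sup] (which has this very definition) is restricted
    to a [realType]. *)
Definition ebar_sup S : \bar K := supremum -oo S.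

Definition ebar_inf S : \bar K := infimum +oo S.

End Suprema.

Lemma int_max (P : int -> Prop) (M : int) :
  (exists z, P z) -> (forall z, P z -> (z <= M)%R) ->
  exists2 m, P m & forall z, P z -> (z <= m)%R.
Proof.
move=> [z0 Pz0] PM.
have toM z : P z -> z = (M - Posz (absz (M - z)%R))%R.
  by move=> Pz; rewrite gez0_abs ?subr_ge0 ?PM// subKr.
have exn : exists n : nat, `[< P (M - Posz n)%R >].
  by exists (absz (M - z0)%R); apply/asboolP; rewrite -toM.
case: (ex_minnP exn) => n /asboolP Pn nmin.
exists (M - Posz n)%R => // z Pz.
rewrite (toM z Pz) lerD2l lerN2 lez_nat; apply: nmin.
by apply/asboolP; rewrite -toM.
Qed.

Lemma supremums_neq0 (K : ground) (S : set (\bar K)) : supremums S !=set0.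
Proof.
case: K S => [|R] S /=; last exact: ereal_supremums_neq0.
have [Soo|Soo] := pselect (S +oo).
  by exists +oo; split=> [x _|x]; [exact: leey|exact].
have [[z0 Sz0]|Sfin] := pselect (exists z : int, S z%:E); last first.
  exists -oo; split=> [[z| |]|x _] //; last exact: leNye.
  by move=> Sz; case: Sfin; exists z.
have [[M SM]|nbd] := pselect (exists M : int, forall z, S z%:E -> (z <= M)%R).
  have [|m Sm mS] := @int_max (fun z => S z%:E) M _ SM; first by exists z0.
  exists m%:E; split=> [[z| |]|x]; last exact.
  - by move=> /mS; rewrite lee_fin.
  - by move=> /Soo.
  - by move=> _; exact: leNye.
exists +oo; split=> [x _|[M| |]] //; first exact: leey.
- move=> SM; case: nbd; exists M => z /SM.
  by rewrite lee_fin.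
- by move=> /(_ _ Sz0).
Qed.

Lemma infimums_neq0 (K : ground) (S : set (\bar K)) : infimums S !=set0.
Proof.
have [m [um lm]] := supremums_neq0 (oppe @` S).
exists (- m); split=> [x Sx|x lx].
  by rewrite leeNl; apply: um; exists x.
rewrite leeNr; apply: lm => _ [y Sy <-].
by rewrite leeN2; exact: lx.
Qed.

Section SupremaTheory.
Variable K : ground.
Implicit Types (S : set (\bar K)) (x y z : \bar K).

Lemma ebar_supremums S : supremums S (ebar_sup S).
Proof.
rewrite /ebar_sup /supremum; case: ifPn => [/eqP ->|_].
  by split=> [x []|x _]; exact: leNye.
case: xgetP => [y _ //|Snone].
by have [x /Snone] := supremums_neq0 S.
Qed.

Lemma ebar_infimums S : infimums S (ebar_inf S).
Proof.
rewrite /ebar_inf /infimum; case: ifPn => [/eqP ->|_].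
  by split=> [x []|x _]; exact: leey.
case: xgetP => [y _ //|Snone].
by have [x /Snone] := infimums_neq0 S.
Qed.

Lemma ebar_sup_ub S x : S x -> x <= ebar_sup S.
Proof. by case: (ebar_supremums S) => + _; apply. Qed.

Lemma ebar_sup_le S y : (forall x, S x -> x <= y) -> ebar_sup S <= y.
Proof. by move=> Sy; case: (ebar_supremums S) => _; apply. Qed.

Lemma ebar_inf_lb S x : S x -> ebar_inf S <= x.
Proof. by case: (ebar_infimums S) => + _; apply. Qed.

Lemma ebar_inf_ge S y : (forall x, S x -> y <= x) -> y <= ebar_inf S.
Proof. by move=> Sy; case: (ebar_infimums S) => _; apply. Qed.

Lemma sube_le_dual_adde x y z : (y - x <= z) = (y <= (x + z)%dE).
Proof.
case: x y z => [x||] [y||] [z||]; rewrite /adde /dual_adde /=;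
  by rewrite ?lee_fin ?lerBlDl ?leey ?leNye ?leye_eq ?leeNy_eq.
Qed.

Lemma sube_triangle x y z : z - x <= ((y - x)%E + (z - y)%E)%dE.
Proof.
rewrite sube_le_dual_adde daddeA.
apply: (@le_trans _ _ (y + (z - y)%E)%dE).
  by rewrite -sube_le_dual_adde lexx.
by apply: lee_dD2r; rewrite -sube_le_dual_adde lexx.
Qed.

Lemma subee_le0 x : x - x <= 0.
Proof. by rewrite sube_le_dual_adde dadde0. Qed.

End SupremaTheory.

Record kcat (K : ground) := KCat {
  Ob :> Type;
  dist : Ob -> Ob -> \bar K;
  dist_triangle : forall a b c, dist a c <= (dist a b + dist b c)%dE;
  dist_self : forall a, dist a a <= 0
}.

Section Categories.
Variable K : ground.
Implicit Types A B : kcat K.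

Definition nonexpansive A B (f : A -> B) : Prop :=
  forall a a', dist (f a) (f a') <= dist a a'.

Record kfunctor A B := KFunctor {
  Ob_fun :> A -> B;
  kfunctorP : nonexpansive Ob_fun
}.

Definition kcat_iso A B : Prop :=
  exists (F : kfunctor A B) (G : kfunctor B A), cancel F G /\ cancel G F.

Definition Kbar_cat : kcat K :=
  @KCat K (\bar K) (fun x y => y - x) (@sube_triangle K) (@subee_le0 K).

End Categories.

Record lconvex (K : ground) := LConvex {
  Ind : Type;
  points : set (Ind -> \bar K);
  points_inf : forall S : set (Ind -> \bar K), S `<=` points ->
    points (fun v => ebar_inf [set p v | p in S]);
  points_sup : forall S : set (Ind -> \bar K), S `<=` points ->
    points (fun v => ebar_sup [set p v | p in S]);
  points_weight : forall (p : Ind -> \bar K) (alpha : \bar K), points p ->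
    points (fun v => (p v + alpha)%dE)
}.

Arguments points {K} _ _.

Section LConvexSets.
Variable K : ground.
Implicit Types D E F : lconvex K.

Record lhom D E := LHom {
  Ind_fun : Ind E -> Ind D;
  lhomP : forall p, points D p -> points E (p \o Ind_fun)
}.

Definition lhom_app D E (Phi : lhom D E) (p : Ind D -> \bar K) :
  Ind E -> \bar K := p \o Ind_fun Phi.

Definition lhom_id D : lhom D D := @LHom D D id (fun p Dp => Dp).

Definition lhom_comp D E F (Psi : lhom E F) (Phi : lhom D E) : lhom D F :=
  @LHom D F (Ind_fun Phi \o Ind_fun Psi)
    (fun p Dp => lhomP Psi (lhomP Phi Dp)).

Definition lconvex_iso D E : Prop :=
  exists (Phi : lhom D E) (Psi : lhom E D),
    lhom_comp Psi Phi = lhom_id D /\ lhom_comp Phi Psi = lhom_id E.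

Definition Kbar_lconvex : lconvex K :=
  @LConvex K unit setT (fun _ _ => I) (fun _ _ => I) (fun _ _ _ => I).

End LConvexSets.

Section FunctorLConvex.
Variables (K : ground) (A : kcat K).

Definition functor_points : set (A -> \bar K) :=
  [set f | @nonexpansive K A (Kbar_cat K) f].

Lemma functor_pointsE (f : A -> \bar K) :
  functor_points f <-> forall a a', f a' <= (f a + dist a a')%dE.
Proof.
by split=> fA a a'; have := fA a a'; rewrite /= sube_le_dual_adde.
Qed.

Lemma functor_points_inf (S : set (A -> \bar K)) : S `<=` functor_points ->
  functor_points (fun a => ebar_inf [set f a | f in S]).
Proof.
move=> SA; apply/functor_pointsE => a a'.
rewrite daddeC -sube_le_dual_adde; apply: ebar_inf_ge => _ [f Sf <-].
rewrite sube_le_dual_adde daddeC.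
apply: (@le_trans _ _ (f a')); first by apply: ebar_inf_lb; exists f.
by move/SA/functor_pointsE: Sf; apply.
Qed.

Lemma functor_points_sup (S : set (A -> \bar K)) : S `<=` functor_points ->
  functor_points (fun a => ebar_sup [set f a | f in S]).
Proof.
move=> SA; apply/functor_pointsE => a a'; apply: ebar_sup_le => _ [f Sf <-].
apply: (@le_trans _ _ (f a + dist a a')%dE).
  by move/SA/functor_pointsE: Sf; apply.
by apply: lee_dD2r; apply: ebar_sup_ub; exists f.
Qed.

Lemma functor_points_weight (f : A -> \bar K) (alpha : \bar K) :
  functor_points f -> functor_points (fun a => (f a + alpha)%dE).
Proof.
move=> /functor_pointsE fA; apply/functor_pointsE => a a'.
by rewrite daddeAC; apply: lee_dD2r.
Qed.

Definition functor_lconvex : lconvex K :=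
  @LConvex K A functor_points
    functor_points_inf functor_points_sup functor_points_weight.

End FunctorLConvex.

Section HomCategory.
Variables (K : ground) (D : lconvex K).

Implicit Types Phi Psi Chi : lhom D (Kbar_lconvex K).

(** The value at [tt] identifies [unit -> \bar K] with [\bar K]. *)
Definition hom_dist Phi Psi : \bar K :=
  ebar_sup [set lhom_app Psi p tt - lhom_app Phi p tt | p in points D].

Lemma hom_dist_triangle Phi Psi Chi :
  hom_dist Phi Chi <= (hom_dist Phi Psi + hom_dist Psi Chi)%dE.
Proof.
apply: ebar_sup_le => _ [p Dp <-].
apply: (le_trans (sube_triangle _ (lhom_app Psi p tt) _)).
by apply: lee_dD; apply: ebar_sup_ub; exists p.
Qed.

Lemma hom_dist_self Phi : hom_dist Phi Phi <= 0.
Proof. by apply: ebar_sup_le => _ [p _ <-]; exact: subee_le0. Qed.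

Definition hom_kcat : kcat K :=
  @KCat K (lhom D (Kbar_lconvex K)) hom_dist hom_dist_triangle hom_dist_self.

End HomCategory.

(* Main.v *)
Require Import Defs.
From mathcomp Require Import all_boot all_order all_algebra.
From mathcomp Require Import boolp classical_sets ereal.
Set Implicit Arguments.
Unset Strict Implicit.
Unset Printing Implicit Defensive.
Import Order.TTheory GRing.Theory Num.Theory DualAddTheory.
Local Open Scope classical_set_scope.
Local Open Scope ring_scope.
Local Open Scope ereal_scope.

(** Every coordinate map on an L-convex set [D] is a homomorphism to the line,
    and there are no others: a homomorphism [D -> Kbar] is a choice of one
    element of [Ind D].  Hence both round trips are the identity on underlying
    sets up to this identification, and what remains is that the two structures
    determine each other.

    For a category [A], the distance recovered from the functors on [A] is
    [sup_f (f a' - f a)].  It is at most [dist a a'] because each [f] is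
    nonexpansive, and this bound is reached at the Yoneda functor
    [f := dist a] (lemma [hom_dist_functor]).

    For an L-convex set [D], put [d v w := sup_(p in D) (p w - p v)].  Points of
    [D] are clearly functors for [d].  Conversely a functor [q] for [d]
    satisfies [q w = inf_v (d v w + q v)]: functoriality says that the left
    side is the smaller one, and the term [v := w] gives the converse because
    [d w w <= 0].  So [q] lies in [D], by completeness under infima and weights,
    as soon as every row [d v] does; and [d v] is a supremum of the maps
    [p - p v], so everything reduces to closure under subtracting a constant
    (lemma [points_sub]).  The only delicate point is that subtracting an
    infinite constant is not adding its opposite; but [y - x] is always the
    supremum of the sums [y + b] over the [b] with [b + x <= 0]
    (lemma [sube_sup]), and completeness under suprema applies. *)

Section ExtendedSubtraction.
Variable K : ground.
Implicit Types x y b : \bar K.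

Lemma le_sub_npos x y : x <= 0 -> y <= y - x.
Proof.
move: x y => [x||] [y||]; rewrite /adde /= ?leey ?leNye // !lee_fin => x0.
by rewrite lerDl oppr_ge0.
Qed.

(** When [x = -oo] the admissible [b] are all those other than [+oo], so that
    the supremum is [+oo] unless [y = -oo]; when [x = +oo] there are none, and
    the supremum of the empty set is [-oo].  These are the two values that
    adding a single constant to [y] cannot produce. *)
Lemma sube_sup x y :
  y - x = ebar_sup [set (y + b)%dE | b in [set b | (b + x)%dE <= 0]].
Proof.
apply/eqP; rewrite eq_le; apply/andP; split; last first.
  apply: ebar_sup_le => _ [b /= bx <-].
  move: x y b bx => [x||] [y||] [b||] //=;
    rewrite /adde /dual_adde /= ?lee_fin ?leey ?leNye // => bx.
  by rewrite lerD2l -subr_ge0 -opprD oppr_ge0 addrC.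
set s := ebar_sup _.
have ub b : (b + x)%dE <= 0 -> (y + b)%dE <= s.
  by move=> bx; apply: ebar_sup_ub; exists b.
move: x y @s ub => [x||] [y||] s ub; rewrite /adde /= ?leey ?leNye //.
1,2: by apply: (ub (- x)%:E); rewrite /dual_adde /= lee_fin addNr.
- (* A finite upper bound [m] is beaten by [b := m - y + 1]. *)
  case: s ub => [m||] ub //.
    by have := ub (m - y + 1)%:E (leNye _);
      rewrite /dual_adde /= lee_fin addrA subrKC gerDl ler10.
  by have := ub 0 (leNye _).
- exact: (ub 0 (leNye _)).
Qed.

End ExtendedSubtraction.

Section Coordinates.
Variable K : ground.
Implicit Types D E : lconvex K.

Lemma lhom_eq D E (Phi Psi : lhom D E) :
  Ind_fun Phi = Ind_fun Psi -> Phi = Psi.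
Proof.
case: Phi Psi => [f fP] [g gP] /= fg; move: fP gP; rewrite fg => fP gP.
by rewrite (Prop_irrelevance fP gP).
Qed.

Definition coord_hom D (v : Ind D) : lhom D (Kbar_lconvex K) :=
  @LHom K D (Kbar_lconvex K) (fun _ => v) (fun _ _ => I).

Definition hom_coord D (Phi : lhom D (Kbar_lconvex K)) : Ind D :=
  Ind_fun Phi tt.

Lemma hom_coordK D : cancel (@hom_coord D) (@coord_hom D).
Proof. by move=> Phi; apply: lhom_eq; apply: funext => -[]. Qed.

End Coordinates.

(** The bound is attained by the representable functor [dist a], which is
    nonexpansive by the triangle inequality; [dist a a] may be negative, but
    subtracting it then only increases the value. *)
Lemma hom_dist_functor (K : ground) (A : kcat K) (a a' : A) :
  hom_dist (coord_hom (D := functor_lconvex A) a)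
           (coord_hom (D := functor_lconvex A) a') = dist a a'.
Proof.
apply/eqP; rewrite eq_le; apply/andP; split.
  by apply: ebar_sup_le => _ [f fA <-]; exact: fA.
apply: (@le_trans _ _ (dist a a' - dist a a)).
  exact/le_sub_npos/dist_self.
apply: ebar_sup_ub; exists (dist a) => //.
by apply/functor_pointsE => b c; exact: dist_triangle.
Qed.

Section PointsAreFunctors.
Variables (K : ground) (D : lconvex K).
Implicit Types (p q : Ind D -> \bar K) (v w : Ind D).

Lemma points_sub p (x : \bar K) :
  points D p -> points D (fun w => p w - x).
Proof.
move=> Dp.
pose S := [set (fun w => (p w + b)%dE) | b in [set b : \bar K | (b + x)%dE <= 0]].
have -> : (fun w => p w - x) = (fun w => ebar_sup [set r w | r in S]).
  by apply: funext => w; rewrite sube_sup image_comp.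
by apply: points_sup => _ [b _ <-]; exact: points_weight.
Qed.

Lemma points_hom_dist v :
  points D (fun w => hom_dist (coord_hom v) (coord_hom w)).
Proof.
pose S := [set (fun w => p w - p v) | p in points D].
have -> : (fun w => hom_dist (coord_hom v) (coord_hom w)) =
          (fun w => ebar_sup [set r w | r in S]).
  by apply: funext => w; rewrite image_comp.
by apply: points_sup => _ [p Dp <-]; exact: points_sub.
Qed.

(** The converse holds because a functor is the infimum of the weighted rows of
    the distance that dominate it, just as every copresheaf is a colimit of
    representables. *)
Lemma pointsE q :
  points D q <->
  forall v w, q w <= (q v + hom_dist (coord_hom v) (coord_hom w))%dE.
Proof.
split=> [Dq v w|qd].
  by rewrite -sube_le_dual_adde; apply: ebar_sup_ub; exists q.
pose row v w := (hom_dist (coord_hom v) (coord_hom w) + q v)%dE.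
have -> : q = (fun w => ebar_inf [set r w | r in range row]).
  apply: funext => w; apply/eqP; rewrite eq_le; apply/andP; split.
    by apply: ebar_inf_ge => _ [_ [v _ <-] <-]; rewrite /row daddeC.
  apply: (@le_trans _ _ (row w w)).
    by apply: ebar_inf_lb; exists (row w) => //; exists w.
  rewrite /row -[leRHS]dadd0e; apply: lee_dD2r; exact: hom_dist_self.
apply: points_inf => _ [v _ <-].
exact/points_weight/points_hom_dist.
Qed.

End PointsAreFunctors.

Theorem theorem3p9 (K : ground) (A : kcat K) (D : lconvex K) :
  kcat_iso A (hom_kcat (functor_lconvex A)) /\
  lconvex_iso D (functor_lconvex (hom_kcat D)).
Proof.
split.
  have coord_ne : @nonexpansive K A (hom_kcat (functor_lconvex A))
      (@coord_hom K (functor_lconvex A)).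
    by move=> a a'; rewrite /= hom_dist_functor.
  have hom_ne : @nonexpansive K (hom_kcat (functor_lconvex A)) A
      (@hom_coord K (functor_lconvex A)).
    by move=> Phi Psi; rewrite -hom_dist_functor !hom_coordK.
  exists (KFunctor coord_ne), (KFunctor hom_ne).
  by split=> // Phi; exact: hom_coordK.
have hom_pts p : points D p ->
    points (functor_lconvex (hom_kcat D)) (p \o @hom_coord K D).
  move=> /pointsE pd; apply/functor_pointsE => Phi Psi.
  by have := pd (hom_coord Phi) (hom_coord Psi); rewrite !hom_coordK.
have coord_pts q : points (functor_lconvex (hom_kcat D)) q ->
    points D (q \o @coord_hom K D).
  by move=> /functor_pointsE qd; apply/pointsE => v w; exact: qd.
exists (@LHom K D (functor_lconvex (hom_kcat D)) _ hom_pts).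
exists (@LHom K (functor_lconvex (hom_kcat D)) D _ coord_pts).
split; apply: lhom_eq => //=.
by apply: funext => Phi; exact: hom_coordK.
Qed.
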